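(* Let $A,B>0$ be constants, let $\lambda\in\mathbb{R}$, and assume that $N\sim\mathrm{Binomial}(e^{nA},e^{-nB})$. Then the upper tail is $$\lim_{n\to\infty}-\frac{1}{n}\ln\Pr\left[N>e^{n\lambda}\right]=\begin{cases}[B-A]_{+}, & [A-B]_{+}\geq\lambda,\\ \infty, & \text{elsewhere},\end{cases}$$ and the lower tail is $$\lim_{n\to\infty}-\frac{1}{n}\ln\Pr\left[N<e^{n\lambda}\right]=\begin{cases}0, & A-B<\lambda,\\ \infty, & A-B>\lambda.\end{cases}$$
   Context: Here $n$ is a positive integer (the blocklength) tending to infinity, $A,B,\lambda$ do not depend on $n$, and $N=N_n$ depends on $n$. $[t]_{+}=\max\{t,0\}$. $\mathrm{Binomial}(m,p)$ is the distribution of the number of successes in $m$ independent trials, each with success probability $p$; integer constraints on large quantities are ignored, so the number of trials $e^{nA}$ is to be read as $\lceil e^{nA}\rceil$. A limit equal to $\infty$ means that $-\frac{1}{n}\ln\Pr[\cdot]$ diverges to $+\infty$ (the probability decays super-exponentially in $n$), with the convention $-\ln 0=+\infty$.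
   Formalization: The upper tail excludes A<B with λ=0 (there Pr[N>1]=Pr[N≥2] has rate 2(B−A), not B−A), and the lower tail's ∞ case is stated only for A>B (if λ<A−B≤0, the event is N=0 and the limit is 0). *)

(* Defs.v *)
From HB Require Import structures.
From mathcomp Require Import all_boot all_order all_algebra.
From mathcomp Require Import all_classical all_reals all_analysis.
Set Implicit Arguments.
Unset Strict Implicit.
Unset Printing Implicit Defensive.
Import Order.TTheory GRing.Theory Num.Theory.
Import numFieldNormedType.Exports.
Local Open Scope ring_scope.

Definition num_trials (R : realType) (A : R) (n : nat) : nat :=
  `|Num.ceil (expR (n%:R * A))|%N.

Definition success_prob (R : realType) (B : R) (n : nat) : R :=
  expR (- (n%:R * B)).

(* [lne 0 = -oo], so the value is [+oo] when [p n = 0] and [0 < n].  The value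
   at [n = 0] is the junk value [0]; only limits at infinity are taken. *)
Definition decay_rate (R : realType) (p : nat -> \bar R) (n : nat) : \bar R :=
  (- ((n%:R^-1)%:E * lne (p n)))%E.

(* Main.v *)
(* Upper tail: if A >= B, a fourth-moment argument shows that N exceeds its mean
   with probability bounded away from 0; if A < B and lambda < 0, the event is
   N >= 1, whose probability is of the order of the mean; above the mean and
   above 1, Chernoff's bound is doubly exponential in n.  Lower tail: Markov's
   inequality shows that N is above e^(n lambda) with vanishing probability when
   A - B < lambda, and Chernoff's bound applies when lambda < A - B. *)
Require Import Defs.
From HB Require Import structures.
From mathcomp Require Import all_boot all_order all_algebra.
From mathcomp Require Import all_classical all_reals all_analysis.
From mathcomp Require Import ring lra.
Set Implicit Arguments.
Unset Strict Implicit.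
Unset Printing Implicit Defensive.
Import Order.TTheory GRing.Theory Num.Theory.
Import numFieldNormedType.Exports.
Local Open Scope classical_set_scope.
Local Open Scope ring_scope.

(** * Binomial expectations as finite sums *)

Section BinomialExpectation.
Context {R : realType}.
Implicit Types (m : nat) (p : R) (f g : nat -> R) (U : set nat).

(** A finite real sum rather than an integral, so that moments follow by induction on [m] and ring
    identities; [binomial_prob_Ebin] ties it to the measure [binomial_prob]. *)
Definition Ebin m p f : R := \sum_(k < m.+1) binomial_pmf m p k * f k.

Lemma eq_Ebin m p f g : f =1 g -> Ebin m p f = Ebin m p g.
Proof. by move=> fg; apply: eq_bigr => k _; rewrite fg. Qed.

Lemma EbinD m p f g : Ebin m p (fun k => f k + g k) = Ebin m p f + Ebin m p g.
Proof. by rewrite -big_split/=; apply: eq_bigr => k _; rewrite mulrDr. Qed.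

Lemma EbinZ m p c f : Ebin m p (fun k => c * f k) = c * Ebin m p f.
Proof. by rewrite mulr_sumr; apply: eq_bigr => k _; rewrite mulrCA. Qed.

Lemma le_Ebin m p f g : 0 <= p <= 1 -> (forall k, f k <= g k) ->
  Ebin m p f <= Ebin m p g.
Proof.
move=> p01 fg; apply: ler_sum => k _.
by rewrite ler_wpM2l// binomial_pmf_ge0.
Qed.

Lemma Ebin0 p f : Ebin 0 p f = f 0%N.
Proof.
by rewrite /Ebin big_ord1 /binomial_pmf bin0 mulr1n subn0 !expr0 !mul1r.
Qed.

Lemma binomial_pmf0 m p : binomial_pmf m p 0 = (1 - p) ^+ m.
Proof. by rewrite /binomial_pmf bin0 subn0 expr0 mul1r. Qed.

Lemma binomial_pmf_small m p k : (m < k)%N -> binomial_pmf m p k = 0.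
Proof. by move=> mk; rewrite /binomial_pmf bin_small. Qed.

(** Pascal's rule: the extra trial either fails or succeeds. *)
Lemma binomial_pmfS m p k : (k <= m)%N ->
  binomial_pmf m.+1 p k.+1
    = (1 - p) * binomial_pmf m p k.+1 + p * binomial_pmf m p k.
Proof.
(* At [k = m] the first summand vanishes. Otherwise [k < m], so that [m - k] is the successor of
   [m - k.+1] despite truncated subtraction. *)
rewrite leq_eqVlt => /predU1P[->|km].
  rewrite [in X in _ = X + _]binomial_pmf_small// mulr0 add0r /binomial_pmf.
  by rewrite !binn !subnn !expr0 !mulr1 exprS.
rewrite /binomial_pmf binS subSS -(subnSK km) mulrnDr [p ^+ k.+1]exprS.
by rewrite (exprS (unstable.onem p)) /unstable.onem; ring.
Qed.

(** Conditioning on one trial; this recursion drives every induction on [m] below. *)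
Lemma EbinS m p f :
  Ebin m.+1 p f = (1 - p) * Ebin m p f + p * Ebin m p (fun k => f k.+1).
Proof.
(* Adding the null term [k = m.+1] gives both sides the same index range before [k = 0] is split
   off. *)
have -> : Ebin m p f = \sum_(k < m.+2) binomial_pmf m p k * f k.
  by rewrite [RHS]big_ord_recr/= binomial_pmf_small// mul0r addr0.
rewrite {1}/Ebin !(big_ord_recl m.+1)/= !binomial_pmf0 exprS mulrDr -!addrA.
rewrite mulrA; congr +%R; rewrite !mulr_sumr -big_split/=.
apply: eq_bigr => k _; rewrite /bump add1n binomial_pmfS; last exact: leq_ord.
by ring.
Qed.

(** The probability generating function: [z = 1] gives the total mass, [z = 0] the probability of no
    success, [z = expR theta] Chernoff's bound. *)
Lemma Ebin_gen m p z : Ebin m p (fun k => z ^+ k) = (1 - p + p * z) ^+ m.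
Proof.
elim: m => [|m IH]; first by rewrite Ebin0 !expr0.
rewrite EbinS IH (eq_Ebin _ _ (g := fun k => z * z ^+ k)); last first.
  by move=> k; rewrite exprS.
by rewrite EbinZ IH exprS; ring.
Qed.

Lemma Ebin_cst m p c : Ebin m p (fun=> c) = c.
Proof.
rewrite (eq_Ebin _ _ (g := fun k => c * 1 ^+ k)); last first.
  by move=> k; rewrite expr1n mulr1.
by rewrite EbinZ Ebin_gen mulr1 subrK expr1n mulr1.
Qed.

Lemma binomial_prob_Ebin m p U : 0 <= p <= 1 ->
  binomial_prob m p U = (Ebin m p (\1_U))%:E.
Proof.
move=> /andP[p0 p1]; rewrite (@binomial_probE _ m p p0 p1) /Ebin -sumEFin.
apply: eq_bigr => k _; rewrite /bin_prob /binomial_pmf /= EFinM.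
by rewrite diracE indicE.
Qed.

Lemma Ebin_indic_ge0 m p U : 0 <= p <= 1 -> 0 <= Ebin m p (\1_U).
Proof.
by move=> p01; rewrite -[leLHS](Ebin_cst m p); apply: le_Ebin.
Qed.

Lemma Ebin_indic_le1 m p U : 0 <= p <= 1 -> Ebin m p (\1_U) <= 1.
Proof.
by move=> p01; rewrite -[leRHS](Ebin_cst m p); apply: le_Ebin.
Qed.

(** * Central moments up to order four, and tail bounds for fixed [m] and [p] *)

Definition central_moment m p j : R :=
  Ebin m p (fun k => (k%:R - m%:R * p) ^+ j).

(** Linearity, stated so that the only obligation is a polynomial identity that [ring] decides. *)
Lemma Ebin_quartic m p f (c0 c1 c2 c3 c4 : R) :
  (forall k, f k = c0 + c1 * (k%:R - m%:R * p) + c2 * (k%:R - m%:R * p) ^+ 2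
    + c3 * (k%:R - m%:R * p) ^+ 3 + c4 * (k%:R - m%:R * p) ^+ 4) ->
  Ebin m p f = c0 + c1 * central_moment m p 1 + c2 * central_moment m p 2
    + c3 * central_moment m p 3 + c4 * central_moment m p 4.
Proof. by move=> /eq_Ebin ->; rewrite !EbinD !EbinZ Ebin_cst. Qed.

(** The mean grows by [p] per trial, so the deviation shifts by [- p] on failure and by [1 - p] on
    success. *)
Lemma central_momentS m p j :
  central_moment m.+1 p j
    = (1 - p) * Ebin m p (fun k => (k%:R - m%:R * p - p) ^+ j)
      + p * Ebin m p (fun k => (k%:R - m%:R * p + (1 - p)) ^+ j).
Proof.
rewrite /central_moment EbinS; congr (_ * _ + _ * _); apply: eq_Ebin => k.
  by congr (_ ^+ _); rewrite -[m.+1]addn1 natrD; ring.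
by congr (_ ^+ _); rewrite -[m.+1]addn1 -[k.+1]addn1 !natrD; ring.
Qed.

Lemma central_moment1 m p : central_moment m p 1 = 0.
Proof.
elim: m => [|m IH]; first by rewrite /central_moment Ebin0 mul0r subr0.
rewrite central_momentS.
rewrite (@Ebin_quartic _ _ _ (- p) 1 0 0 0); last by move=> k; ring.
rewrite (@Ebin_quartic _ _ _ (1 - p) 1 0 0 0); last by move=> k; ring.
by rewrite IH; ring.
Qed.

Lemma central_moment2 m p : central_moment m p 2 = m%:R * p * (1 - p).
Proof.
elim: m => [|m IH].
  by rewrite /central_moment Ebin0 !mul0r subr0 expr0n.
rewrite central_momentS.
rewrite (@Ebin_quartic _ _ _ (p ^+ 2) (- (2 * p)) 1 0 0); last first.
  by move=> k; ring.
rewrite (@Ebin_quartic _ _ _ ((1 - p) ^+ 2) (2 * (1 - p)) 1 0 0); last first.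
  by move=> k; ring.
by rewrite IH central_moment1 -[m.+1]addn1 natrD; ring.
Qed.

Lemma central_moment4 m p : central_moment m p 4 =
  3 * (m%:R * p * (1 - p)) ^+ 2 + m%:R * p * (1 - p) * (1 - 6 * (p * (1 - p))).
Proof.
elim: m => [|m IH].
  by rewrite /central_moment Ebin0 !mul0r subr0 !expr0n/= mulr0 addr0.
rewrite central_momentS.
(* The coefficients expand [(x - p) ^+ 4] and [(x + (1 - p)) ^+ 4]. The third moment cancels: its
   weights are [- 4 * p * (1 - p)] and [4 * p * (1 - p)]. *)
rewrite (@Ebin_quartic _ _ _
  (p ^+ 4) (- (4 * p ^+ 3)) (6 * p ^+ 2) (- (4 * p)) 1); last by move=> k; ring.
rewrite (@Ebin_quartic _ _ _ ((1 - p) ^+ 4) (4 * (1 - p) ^+ 3)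
  (6 * (1 - p) ^+ 2) (4 * (1 - p)) 1); last by move=> k; ring.
by rewrite IH central_moment2 central_moment1 -[m.+1]addn1 natrD; ring.
Qed.

(* Taking s = sigma and x = N - E[N], this bounds P(N > E[N]) from below by
   (8 sigma^4 - E[(N - E[N])^4]) / (40 sigma^4): the linear term is centered. *)
Lemma quartic_le_indicator (s x : R) : 0 < s ->
  10 * s ^+ 3 * x + 8 * s ^+ 2 * x ^+ 2 - x ^+ 4 <= 40 * s ^+ 4 * (0 < x)%R%:R.
Proof.
(* Rescaling reduces to [s = 1], that is, to [10 u + 8 u^2 - u^4] against [40] or [0]. *)
move=> s0; have [u ->] : exists u, x = s * u.
  by exists (x / s); rewrite mulrC divfK// gt_eqF.
rewrite pmulr_rgt0//.
have -> : 10 * s ^+ 3 * (s * u) + 8 * s ^+ 2 * (s * u) ^+ 2 - (s * u) ^+ 4 =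
          s ^+ 4 * (10 * u + 8 * u ^+ 2 - u ^+ 4) by ring.
rewrite [leRHS]mulrAC [leRHS]mulrC ler_wpM2l ?exprn_ge0 ?(ltW s0)//.
have [u0|u0] := ltP 0 u; rewrite ?mulr1n ?mulr0n ?mulr0 ?mulr1.
  (* Certificate: [40 - 10 u - 8 u^2 + u^4 = (u^2 - 5)^2 + 2 (u - 5/2)^2 + 5/2]. *)
  have := sqr_ge0 (u ^+ 2 - 5); have := sqr_ge0 (u - 5 / 2); nra.
(* With [w = - u >= 0] the claim is [w (w^3 - 8 w + 10) >= 0]. The cubic exceeds the displayed
   nonnegative factor by [13/54]; [5/3] is close to its minimizer. *)
have : 0 <= - u * ((- u - 5 / 3) ^+ 2 * (- u + 10 / 3) + (- u) / 3 + 1 / 2).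
  rewrite mulr_ge0 ?oppr_ge0// addr_ge0// addr_ge0//.
    by rewrite mulr_ge0 ?sqr_ge0//; lra.
  by lra.
lra.
Qed.

(** With variance [v], the quartic minorant has expectation [8 v^2 - E[x^4] = 5 v^2 - v + 6 v p (1 -
    p)], at least [3 v^2] once [v >= 1/2]; dividing by [40 v^2] gives [3 / 40]. *)
Lemma prob_gt_mean_ge m p : 0 <= p <= 1 -> 1 / 2 <= m%:R * p * (1 - p) ->
  3 / 40 <= Ebin m p (\1_[set k : nat | m%:R * p < k%:R]).
Proof.
move=> p01 v2; set v := m%:R * p * (1 - p) in v2.
have v0 : 0 < v by lra.
set s := Num.sqrt v; have s0 : 0 < s by rewrite sqrtr_gt0.
have s2 : s ^+ 2 = v by rewrite sqr_sqrtr// ltW.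
have s4 : s ^+ 4 = v ^+ 2 by rewrite -s2; ring.
rewrite -(@ler_pM2l _ (40 * v ^+ 2)); last by rewrite mulr_gt0// exprn_gt0.
rewrite -EbinZ; set E := Ebin _ _ _.
pose f k := 10 * s ^+ 3 * (k%:R - m%:R * p)
  + 8 * s ^+ 2 * (k%:R - m%:R * p) ^+ 2
  - (k%:R - m%:R * p) ^+ 4.
apply: (@le_trans _ _ (Ebin m p f)); last first.
  apply: le_Ebin => // k; rewrite /f indicE -s4.
  rewrite (_ : (k \in _) = (0 < k%:R - m%:R * p)) ?quartic_le_indicator//.
  rewrite subr_gt0; apply/idP/idP => [/set_mem//|h]; exact/mem_set.
rewrite (@Ebin_quartic _ _ _ 0 (10 * s ^+ 3) (8 * s ^+ 2) 0 (-1)); last first.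
  by move=> k; rewrite /f; ring.
rewrite central_moment1 central_moment2 central_moment4 -/v s2.
case/andP: p01 => p0 p1.
have := mulr_ge0 (ltW v0) (mulr_ge0 p0 (_ : 0 <= 1 - p)).
rewrite subr_ge0 => /(_ p1) h.
nra.
Qed.

(** The indicator is at most [expR (theta * (k - t))], and [1 + x <= expR x] bounds the generating
    function. The sign of [theta] selects the tail. *)
Lemma chernoff_bound m p (theta t : R) U : 0 <= p <= 1 ->
  (forall k, U k -> theta * t <= theta * k%:R) ->
  Ebin m p (\1_U) <= expR (m%:R * p * (expR theta - 1) - theta * t).
Proof.
move=> p01 Ut.
apply: (@le_trans _ _
    (Ebin m p (fun k => expR (- (theta * t)) * expR theta ^+ k))).
  apply: le_Ebin => // k; rewrite indicE -expRM_natr -expRD.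
  have [/set_mem /Ut Uk|_] := boolP (k \in U); last exact: expR_ge0.
  by rewrite -[leLHS]expR0 ler_expR addrC subr_ge0 Uk.
rewrite EbinZ Ebin_gen expRD [leRHS]mulrC ler_wpM2l ?expR_ge0//.
rewrite -mulrA expRM_natl lerXn2r ?nnegrE ?expR_ge0//.
  by case/andP: p01 => p0 p1; rewrite addr_ge0 ?subr_ge0// mulr_ge0// expR_ge0.
by apply: le_trans (expR_ge1Dx _); rewrite le_eqVlt;
  apply/orP; left; apply/eqP; ring.
Qed.

Lemma Ebin_id m p : Ebin m p (fun k => k%:R) = m%:R * p.
Proof.
rewrite (@Ebin_quartic _ _ _ (m%:R * p) 1 0 0 0); last by move=> k; ring.
by rewrite central_moment1; ring.
Qed.

Lemma markov_bound m p (t : R) U : 0 <= p <= 1 -> 0 < t ->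
  (forall k, U k -> t <= k%:R) -> Ebin m p (\1_U) <= m%:R * p / t.
Proof.
move=> p01 t0 Ut; rewrite -Ebin_id mulrC -EbinZ; apply: le_Ebin => // k.
rewrite indicE mulrC; have [/set_mem /Ut Uk|_] := boolP (k \in U).
  by rewrite ler_pdivlMr// mul1r.
by rewrite divr_ge0// ltW.
Qed.

Lemma Ebin_setC m p U : Ebin m p (\1_(~` U)) = 1 - Ebin m p (\1_U).
Proof.
rewrite -[X in X - _](Ebin_cst m p) -mulN1r -EbinZ -EbinD; apply: eq_Ebin => k.
by rewrite !indicE in_setC; case: (k \in U); rewrite /=; ring.
Qed.

(** No success has probability [(1 - p)^m <= expR (- m p) <= 1 / (1 + m p)]. *)
Lemma prob_pos_ge m p : 0 <= p <= 1 ->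
  m%:R * p / (1 + m%:R * p) <= Ebin m p (\1_[set k | (0 < k)%N]).
Proof.
move=> p01; have /andP[p0 p1] := p01.
have -> : Ebin m p (\1_[set k | (0 < k)%N]) = 1 - (1 - p) ^+ m.
  (* The generating function at [0]: since [0 ^+ 0 = 1], [0 ^+ k] is the indicator of [k = 0]. *)
  have -> : 1 - p = 1 - p + p * 0 by rewrite mulr0 addr0.
  rewrite -Ebin_gen.
  rewrite -[X in X - _](Ebin_cst m p) -mulN1r -EbinZ -EbinD.
  apply: eq_Ebin => k; rewrite indicE expr0n; case: k => [|k].
    by rewrite memNset//= mulr1 subrr.
  by rewrite mem_set//= mulr0 addr0.
have mp0 : 0 <= m%:R * p by rewrite mulr_ge0.
have d0 : 0 < 1 + m%:R * p by rewrite ltr_pwDl.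
rewrite ler_pdivrMr//.
have : (1 - p) ^+ m * (1 + m%:R * p) <= 1.
  apply: (@le_trans _ _ (expR (- p) ^+ m * expR (m%:R * p))).
    apply: ler_pM; rewrite ?exprn_ge0 ?subr_ge0 ?expR_ge1Dx ?(ltW d0)//.
    by rewrite lerXn2r ?nnegrE ?subr_ge0 ?expR_ge0 ?expR_ge1Dx.
  by rewrite -expRM_natl -expRD mulrN addNr expR0.
lra.
Qed.
End BinomialExpectation.

(** * From bounds on probabilities to decay rates *)

Section DecayRate.
Context {R : realType}.
Implicit Types (p : nat -> \bar R) (x : R) (n : nat).

Lemma decay_rate_le p n x : (0 < n)%N -> ((expR x)%:E <= p n)%E ->
  (decay_rate p n <= (- x / n%:R)%:E)%E.
Proof.
move=> n0 xp; rewrite /decay_rate mulNr EFinN leeN2 mulrC EFinM.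
rewrite lee_wpmul2l ?lee_fin ?invr_ge0//.
rewrite -[x in x%:E](expRK x) -lne_EFin ?expR_gt0// lee_lne ?in_itv/=
  ?leey ?andbT//.
by apply: le_trans xp; rewrite lee_fin expR_ge0.
Qed.

Lemma decay_rate_ge p n x : (0 < n)%N -> (0 <= p n)%E ->
  (p n <= (expR x)%:E)%E -> ((- x / n%:R)%:E <= decay_rate p n)%E.
Proof.
move=> n0 p0 px; rewrite /decay_rate mulNr EFinN leeN2 mulrC EFinM.
rewrite lee_wpmul2l ?lee_fin ?invr_ge0//.
rewrite -[x in leRHS](expRK x).
by rewrite -lne_EFin ?expR_gt0// lee_lne ?in_itv/= ?leey ?andbT.
Qed.

(** A constant factor [a] changes the rate only by [ln a / n], which tends to [0]. *)
Lemma decay_rate_cvg p (r c C : R) : 0 < c -> 0 < C ->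
  (\forall n \near \oo, (c * expR (- (n%:R * r)))%:E <= p n)%E ->
  (\forall n \near \oo, p n <= (C * expR (- (n%:R * r)))%:E)%E ->
  decay_rate p @ \oo --> r%:E.
Proof.
move=> c0 C0 cp pC.
have cvg_bound a : (r - a / n%:R)%:E @[n --> \oo] --> r%:E.
  apply: cvg_EFin; first by near=> n.
  rewrite -[X in _ --> X]subr0; apply: cvgB; first exact: cvg_cst.
  rewrite -(mulr0 a); apply: cvgM; first exact: cvg_cst.
  (* The harmonic sequence is [1 / (n + 1)], hence the shift. *)
  by rewrite -cvg_shiftS; exact: cvg_harmonic.
have bound a n : (0 < n)%N -> r - a / n%:R = - (a - n%:R * r) / n%:R.
  by move=> n0; field; rewrite pnatr_eq0 -lt0n.
have factor a n : 0 < a -> a * expR (- (n%:R * r)) = expR (ln a - n%:R * r).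
  by move=> a0; rewrite expRD lnK.
apply: (squeeze_cvge _ (cvg_bound (ln C)) (cvg_bound (ln c))).
near=> n.
have n0 : (0 < n)%N by near: n; exact: nbhs_infty_gt.
have cpn : ((c * expR (- (n%:R * r)))%:E <= p n)%E by near: n.
have pCn : (p n <= (C * expR (- (n%:R * r)))%:E)%E by near: n.
rewrite !bound//; apply/andP; split.
  apply: decay_rate_ge; rewrite -?factor//.
  by apply: le_trans cpn; rewrite lee_fin mulr_ge0 ?expR_ge0 ?(ltW c0).
by apply: decay_rate_le; rewrite -?factor.
Unshelve. all: by end_near. Qed.

(** The two exponentials stand for the threshold and the mean in Chernoff's exponent, whichever
    dominates. Their difference outgrows every multiple of [n]. *)
Lemma decay_rate_cvgy p (a b alpha beta : R) :
  0 < a -> 0 <= b -> 0 <= beta -> beta < alpha ->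
  (\forall n \near \oo, 0 <= p n <=
    (expR (- (a * expR (n%:R * alpha) - b * expR (n%:R * beta))))%:E)%E ->
  decay_rate p @ \oo --> +oo%E.
Proof.
move=> a0 b0 be0 ab pb; apply/cvgeyPge => M.
pose dl := alpha - beta; have dl0 : 0 < dl by rewrite subr_gt0.
(* The quadratic Taylor coefficient: [a * expR (n dl) >= h n^2]. *)
pose h := a * dl ^+ 2 / 2.
have h0 : 0 < h by rewrite /h divr_gt0// mulr_gt0// exprn_gt0.
near=> n.
have n0 : (0 < n)%N by near: n; exact: nbhs_infty_gt.
have nn0 : 1 <= n%:R :> R by rewrite ler1n.
have /andP[p0 pn] : (0 <= p n <=
    (expR (- (a * expR (n%:R * alpha) - b * expR (n%:R * beta))))%:E)%E.
  by near: n.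
(* Then [h n^2 >= (|M| + b) n >= |M| n + b], which absorbs both the target [M n] and the subtracted
   [b]. *)
have large : (`|M| + b) / h < n%:R by near: n; exact: nbhs_infty_gtr.
rewrite ltr_pdivrMr// in large.
apply: le_trans (decay_rate_ge n0 p0 pn); rewrite lee_fin opprK.
rewrite ler_pdivlMr ?ltr0n//.
have -> : expR (n%:R * alpha) = expR (n%:R * beta) * expR (n%:R * dl).
  by rewrite -expRD; congr expR; rewrite /dl; ring.
set E := expR (n%:R * beta).
have E1 : 1 <= E by rewrite -expR0 ler_expR mulr_ge0.
have q : 1 + (n%:R * dl) ^+ 2 / 2 <= expR (n%:R * dl).
  by have := @expR_ge1Dxn R (n%:R * dl) 1; apply; rewrite mulr_ge0// ltW.
have q' : h * n%:R ^+ 2 <= a * expR (n%:R * dl).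
  apply: le_trans (ler_wpM2l (ltW a0) q).
  rewrite (_ : h * _ = a * ((n%:R * dl) ^+ 2 / 2)); last by rewrite /h; ring.
  by rewrite ler_wpM2l ?(ltW a0)// lerDr.
have Mn : `|M| * n%:R + b * n%:R <= h * n%:R ^+ 2.
  by rewrite -mulrDl expr2 mulrA ler_wpM2r// mulrC ltW.
have bn : b <= b * n%:R by rewrite ler_peMr.
have M0 : 0 <= `|M| * n%:R by rewrite mulr_ge0.
have MM : M * n%:R <= `|M| * n%:R by rewrite ler_wpM2r// ler_norm.
apply: (le_trans MM).
apply: (@le_trans _ _ (a * expR (n%:R * dl) - b)); first by lra.
(* The common factor [E >= 1] can only increase the nonnegative [a * expR (n dl) - b]. *)
rewrite mulrCA [b * _]mulrC -mulrBr ler_peMl//; lra.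
Unshelve. all: by end_near. Qed.

End DecayRate.

(** * The mean number of successes *)

Section TrialsMean.
Context {R : realType}.
Implicit Types (A B : R) (n : nat).

Local Notation mean A B n := ((num_trials A n)%:R * success_prob B n).

Lemma success_prob01 B n : 0 <= B -> 0 <= success_prob B n <= 1.
Proof. by move=> B0; rewrite expR_ge0 expR_le1 oppr_le0 mulr_ge0. Qed.

(** Rounding up adds less than [1], at most doubling [expR (n A) >= 1]. *)
Lemma mean_bounds A B n : 0 <= A ->
  expR (n%:R * (A - B)) <= mean A B n <= 2 * expR (n%:R * (A - B)).
Proof.
move=> A0; rewrite mulrBr expRD mulrA.
rewrite !ler_pM2r ?expR_gt0// /num_trials.
have e1 : 1 <= expR (n%:R * A) by rewrite -expR0 ler_expR mulr_ge0.
rewrite natr_absz ger0_norm; last first.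
  by rewrite ceil_ge0 (lt_trans _ (expR_gt0 _))// ltrN10.
have /andP[] := ceil_itv (expR (n%:R * A)); rewrite intrB/= => h1 ->/=.
by move: h1; rewrite mulr1z; lra.
Qed.

End TrialsMean.

Lemma near_expR_le (R : realType) (a e : R) : a < 0 -> 0 < e ->
  \forall n \near \oo, expR (n%:R * a) <= e.
Proof.
move=> a0 e0; near=> n.
have large : e^-1 / - a < n%:R by near: n; exact: nbhs_infty_gtr.
rewrite ltr_pdivrMr ?oppr_gt0// in large.
rewrite -[n%:R * a]opprK expRN -[e]invrK lef_pV2 ?posrE ?expR_gt0 ?invr_gt0//.
by rewrite -mulrN; apply: le_trans (expR_ge1Dx _); lra.
Unshelve. all: by end_near. Qed.

(** * The tail regimes *)

Section BinomialTails.
Context {R : realType} (A B lambda : R) (hA : 0 < A) (hB : 0 < B).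

Local Notation m n := (num_trials A n).
Local Notation p n := (success_prob B n).
Local Notation above n := [set k : nat | expR (n%:R * lambda) < k%:R].
Local Notation below n := [set k : nat | k%:R < expR (n%:R * lambda)].

Let p01 n : 0 <= p n <= 1.
Proof. exact: success_prob01 (ltW hB). Qed.

Lemma upper_tail_superexponential : Num.max (A - B) 0 < lambda ->
  decay_rate (fun n => (Ebin (m n) (p n) (\1_(above n)))%:E) @ \oo --> +oo%E.
Proof.
rewrite gt_max => /andP[ABl l0].
have e1 : 0 < expR 1 - 1 :> R by rewrite subr_gt0 expR_gt1.
(* Chernoff with [theta = 1]: the mean, at most [2 * expR (n (A - B))], is multiplied by
   [expR 1 - 1]. The maximum with [0] keeps [beta] nonnegative. *)
apply: (@decay_rate_cvgy _ _ 1 (2 * (expR 1 - 1)) lambda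
  (Num.max (A - B) 0)) => //.
- by rewrite le_max lexx orbT.
- by rewrite gt_max ABl.
near=> n; rewrite lee_fin Ebin_indic_ge0//= lee_fin.
apply: (le_trans (@chernoff_bound _ _ _ 1 (expR (n%:R * lambda)) _ _ _)) => //.
  by move=> k /= /ltW; rewrite !mul1r.
rewrite ler_expR !mul1r opprB lerB// [leRHS]mulrAC.
rewrite ler_wpM2r ?(ltW e1)//.
have /andP[_ /le_trans->//] := mean_bounds B n (ltW hA).
by rewrite ler_wpM2l// ler_expR ler_wpM2l// le_max lexx.
Unshelve. all: by end_near. Qed.

Lemma upper_tail_subexponential : B <= A -> lambda <= A - B ->
  decay_rate (fun n => (Ebin (m n) (p n) (\1_(above n)))%:E) @ \oo --> 0%:E.
Proof.
move=> BA lAB; apply: (@decay_rate_cvg _ _ 0 (3 / 40) 1) => //;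
  near=> n; last first.
  by rewrite mulr0 oppr0 expR0 mulr1 lee_fin Ebin_indic_le1.
have n0 : (0 < n)%N by near: n; exact: nbhs_infty_gt.
(* Together with a mean of at least [1], this makes the variance at least [1 / 2]. *)
have p2 : p n <= 1 / 2.
  rewrite /success_prob -mulrN; near: n.
  by apply: near_expR_le; rewrite ?oppr_lt0//; lra.
rewrite mulr0 oppr0 expR0 mulr1 lee_fin.
have /andP[mn _] := mean_bounds B n (ltW hA).
have m1 : 1 <= (m n)%:R * p n.
  by apply: le_trans mn; rewrite -expR0 ler_expR mulr_ge0// subr_ge0.
(* The threshold lies at or below the mean, boundary case [lambda = A - B] included, so exceeding
   the mean suffices. *)
apply: (@le_trans _ _ (Ebin (m n) (p n)
    (\1_[set k : nat | (m n)%:R * p n < k%:R]))).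
  by apply: prob_gt_mean_ge => //; nra.
apply: le_Ebin => // k; rewrite !indicE ler_nat.
have [/set_mem/= h|//] := boolP (k \in [set k : nat | _ < k%:R]).
rewrite mem_set//=; apply: le_lt_trans h; apply: le_trans mn.
by rewrite ler_expR ler_wpM2l.
Unshelve. all: by end_near. Qed.

Lemma upper_tail_exponential : A < B -> lambda < 0 ->
  decay_rate (fun n => (Ebin (m n) (p n) (\1_(above n)))%:E)
    @ \oo --> (B - A)%:E.
Proof.
(* With [E = expR (n (A - B)) <= 1] and [E <= mu <= 2 E], one has [mu / (1 + mu) >= E / 3], while
   Markov's bound at [1] gives at most [2 E]. *)
move=> AB l0; apply: (@decay_rate_cvg _ _ _ (1 / 3) 2) => //; near=> n.
- have n0 : (0 < n)%N by near: n; exact: nbhs_infty_gt.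
  have -> : above n = [set k | (0 < k)%N].
    have e1 : expR (n%:R * lambda) < 1 by rewrite expR_lt1 pmulr_rlt0 ?ltr0n.
    apply/seteqP; split => k /= h; last by rewrite (lt_le_trans e1)// ler1n.
    by rewrite -(ltr0n R); apply: le_lt_trans h; exact: expR_ge0.
  rewrite lee_fin; apply: le_trans (prob_pos_ge _ (p01 n)).
  rewrite -mulrN opprB.
  have /andP[] := mean_bounds B n (ltW hA); set E := expR _.
  set mu := _ * _ => h1 h2.
  have E0 : 0 < E by exact: expR_gt0.
  have E1 : E <= 1 by rewrite expR_le1 mulr_ge0_le0// subr_le0 ltW.
  by rewrite ler_pdivlMr; nra.
- have n0 : (0 < n)%N by near: n; exact: nbhs_infty_gt.
  have /andP[_ h] := mean_bounds B n (ltW hA).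
  rewrite lee_fin -mulrN opprB; apply: le_trans h.
  rewrite -[leRHS]divr1; apply: markov_bound => // k /= h.
  by rewrite ler1n -(ltr0n R); apply: le_lt_trans h; exact: expR_ge0.
Unshelve. all: by end_near. Qed.

Lemma lower_tail_subexponential : A - B < lambda ->
  decay_rate (fun n => (Ebin (m n) (p n) (\1_(below n)))%:E) @ \oo --> 0%:E.
Proof.
move=> ABl; apply: (@decay_rate_cvg _ _ 0 (1 / 2) 1) => //;
  near=> n; last first.
  by rewrite mulr0 oppr0 expR0 mulr1 lee_fin Ebin_indic_le1.
rewrite mulr0 oppr0 expR0 mulr1 lee_fin -[below n]setCK Ebin_setC.
(* A quarter, because the upper bound on the mean carries a factor [2] and the complement must stay
   below [1 / 2]. *)
have e : expR (n%:R * (A - B - lambda)) <= 1 / 4.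
  by near: n; apply: near_expR_le; rewrite ?subr_lt0.
have := @markov_bound _ (m n) (p n) (expR (n%:R * lambda)) (~` below n) (p01 n)
  (expR_gt0 _).
have /andP[_ h] := mean_bounds B n (ltW hA).
have h' : (m n)%:R * p n / expR (n%:R * lambda) <= 1 / 2.
  rewrite ler_pdivrMr ?expR_gt0//; apply: (le_trans h).
  rewrite -[A - B](subrK lambda) mulrDr expRD mulrA ler_pM2r ?expR_gt0//.
  by lra.
move=> /(_ _)/le_trans => /(_ _ _ h') bnd.
suff : Ebin (m n) (p n) (\1_(~` below n)) <= 1 / 2 by lra.
by apply: bnd => k /= /negP; rewrite -leNgt.
Unshelve. all: by end_near. Qed.

Lemma lower_tail_superexponential : lambda < A - B -> 0 < A - B ->
  decay_rate (fun n => (Ebin (m n) (p n) (\1_(below n)))%:E) @ \oo --> +oo%E.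
Proof.
move=> lAB AB0.
have e1 : 0 < 1 - expR (- 1) :> R by rewrite subr_gt0 expR_lt1 ltrN10.
(* Chernoff with [theta = -1]: now the mean dominates, with factor [1 - expR (- 1)], and the
   threshold is the lesser term. [0 < A - B] ensures [beta < alpha]. *)
apply: (@decay_rate_cvgy _ _ (1 - expR (- 1)) 1 (A - B)
  (Num.max lambda 0)) => //.
- by rewrite le_max lexx orbT.
- by rewrite gt_max lAB.
near=> n; rewrite lee_fin Ebin_indic_ge0//= lee_fin.
apply: (le_trans (@chernoff_bound _ _ _ (-1) (expR (n%:R * lambda))
  _ _ _)) => //.
  by move=> k /= /ltW; rewrite !mulN1r lerN2.
rewrite ler_expR.
have /andP[h _] := mean_bounds B n (ltW hA).
have h2 : expR (n%:R * lambda) <= expR (n%:R * Num.max lambda 0).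
  by rewrite ler_expR ler_wpM2l// le_max lexx.
nra.
Unshelve. all: by end_near. Qed.

End BinomialTails.

(** If [A < B] and [lambda = 0], the upper event is [N >= 2], of rate [2 * (B - A)], hence the
    exclusion. If [lambda < A - B <= 0], the lower event is [N = 0], of probability bounded away
    from [0] and rate [0]; hence [0 < A - B] in the last clause. *)
Theorem theorem1 (R : realType) (A B lambda : R) (hA : 0 < A) (hB : 0 < B)
    (d : nat -> measure_display) (T : forall n, measurableType (d n))
    (P : forall n, probability (T n) R)
    (N : forall n, {RV (P n) >-> nat})
    (hN : forall n, (0 < n)%N ->
      distribution (P n) (N n)
        = binomial_prob (num_trials A n) (success_prob B n)
        :> (set nat -> \bar R)) :
  (~ (A < B /\ lambda = 0) ->
    decay_rate (fun n => P n [set w | expR (n%:R * lambda) < (N n w)%:R])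
      @ \oo -->
    (if lambda <= Num.max (A - B) 0
     then (Num.max (B - A) 0)%:E else +oo%E))
  /\
  (A - B < lambda ->
    decay_rate (fun n => P n [set w | (N n w)%:R < expR (n%:R * lambda)])
      @ \oo --> (0 : \bar R))
  /\
  (A - B > lambda -> 0 < A - B ->
    decay_rate (fun n => P n [set w | (N n w)%:R < expR (n%:R * lambda)])
      @ \oo --> +oo%E).
Proof.
have tailE (U : nat -> set nat) (l : \bar R) :
    decay_rate (fun n => (Ebin (num_trials A n) (success_prob B n)
      (\1_(U n)))%:E)
      @ \oo --> l ->
    decay_rate (fun n => P n [set w | U n (N n w)]) @ \oo --> l.
  apply: cvg_trans; apply: near_eq_cvg; near=> n.
  have n0 : (0 < n)%N by near: n; exact: nbhs_infty_gt.
  rewrite /decay_rate -binomial_prob_Ebin; last exact: success_prob01 (ltW hB).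
  by rewrite -hN.
split; last split.
- move=> nAB.
  apply: (tailE (fun n => [set k : nat | expR (n%:R * lambda) < k%:R])).
  case: ifPn => [|]; last by rewrite -ltNge; exact: upper_tail_superexponential.
  have [AB|BA] := ltP A B.
    rewrite (max_r (_ : A - B <= 0)) ?subr_le0 ?(ltW AB)//.
    rewrite (max_l (_ : 0 <= B - A)) ?subr_ge0 ?(ltW AB)// => l0.
    (* The condition reads [lambda <= 0] here; the excluded case makes it strict. *)
    apply: upper_tail_exponential => //; rewrite lt_neqAle l0 andbT.
    by apply/eqP => l0'; apply: nAB.
  rewrite (max_l (_ : 0 <= A - B)) ?subr_ge0//.
  rewrite (max_r (_ : B - A <= 0)) ?subr_le0// => lAB.
  exact: upper_tail_subexponential.
- move=> ABl.
  apply: (tailE (fun n => [set k : nat | k%:R < expR (n%:R * lambda)])).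
  exact: lower_tail_subexponential.
- move=> lAB AB0.
  apply: (tailE (fun n => [set k : nat | k%:R < expR (n%:R * lambda)])).
  exact: lower_tail_superexponential.
Unshelve. all: by end_near. Qed.
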